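(* $\mathrm{NID}\notin\Sigma_3$.
   Context: Fix a universal prefix-free machine $U$. $K$ denotes prefix-free Kolmogorov complexity and $K(x\mid y)$ conditional prefix-free complexity. For binary strings $x,y$ let $E(x,y)=\max\{K(x\mid y),K(y\mid x)\}$ and $\mathrm{NID}(x,y)=\dfrac{E(x,y)}{\max\{K(x),K(y)\}}$. The oscillation classes: an approximation of $F$ is a computable $f$ with $\lim_{s\to\infty}f(z,s)=F(z)$ for all $z$; $F\in\Sigma_1$ if it has an approximation nondecreasing in $s$; $F\in\Pi_1$ if it has one nonincreasing in $s$; $F\in\Sigma_{n+1}$ if it has a computable approximation $f$ such that for every $z$ there is $s_z$ with $f(z,t)$ nondecreasing for $t<s_z$ and $(f(z,t))_{t\geq s_z}$ a $\Pi_n$-approximation; $F\in\Pi_{n+1}$ likewise with nonincreasing for $t<s_z$ and $(f(z,t))_{t\geq s_z}$ a $\Sigma_n$-approximation. So $\Sigma_3$ means an approximation with phases up, down, up on each input. *)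

(* Defs.v *)
From Stdlib Require Import List Arith ZArith QArith Qabs ClassicalEpsilon.
Local Open Scope nat_scope.
Import ListNotations.

Inductive prcode : Type :=
| PZero : prcode
| PSucc : prcode
| PProj : nat -> prcode
| PComp : prcode -> list prcode -> prcode
| PRec  : prcode -> prcode -> prcode
| PMu   : prcode -> prcode.

Inductive evalR : prcode -> list nat -> nat -> Prop :=
| ev_zero : forall xs, evalR PZero xs 0
| ev_succ : forall x xs, evalR PSucc (x :: xs) (S x)
| ev_proj : forall i xs, evalR (PProj i) xs (nth i xs 0)
| ev_comp : forall f gs xs zs y,
    Forall2 (fun g z => evalR g xs z) gs zs ->
    evalR f zs y -> evalR (PComp f gs) xs y
| ev_rec0 : forall f g xs y, evalR f xs y -> evalR (PRec f g) (0 :: xs) y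
| ev_recS : forall f g n xs r y,
    evalR (PRec f g) (n :: xs) r ->
    evalR g (n :: r :: xs) y -> evalR (PRec f g) (S n :: xs) y
| ev_mu : forall f xs n,
    evalR f (n :: xs) 0 ->
    (forall m, m < n -> exists k, evalR f (m :: xs) (S k)) ->
    evalR (PMu f) xs n.

Definition bstring := list bool.

(* bijection {0,1}^* -> nat *)
Fixpoint enc (s : bstring) : nat :=
  match s with
  | [] => 0
  | b :: s' => 2 * enc s' + (if b then 2 else 1)
  end.

Definition cpair (a b : nat) : nat := (a + b) * (a + b + 1) / 2 + b.
Definition encZ (z : Z) : nat :=
  match z with
  | Z0 => 0
  | Zpos p => 2 * Pos.to_nat p
  | Zneg p => 2 * Pos.to_nat p - 1
  end.
Definition encQ (q : Q) : nat := cpair (encZ (Qnum q)) (Pos.to_nat (Qden q)).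

(* A (conditional) machine is given by a program of arity 2:
   M(p | y) = x  iff  the program on (enc p, enc y) outputs enc x. *)
Definition runs (M : prcode) (p y x : bstring) : Prop :=
  evalR M [enc p; enc y] (enc x).

Definition is_prefix (p q : bstring) : Prop := exists r, q = p ++ r.

Definition prefix_free (M : prcode) : Prop :=
  forall y p q xp xq, runs M p y xp -> runs M q y xq -> is_prefix p q -> p = q.

Definition universal_pf (U : prcode) : Prop :=
  prefix_free U /\
  forall M, prefix_free M ->
    exists c : nat, forall p y x, runs M p y x ->
      exists q, runs U q y x /\ length q <= length p + c.

Definition is_Kc (U : prcode) (x y : bstring) (n : nat) : Prop :=
  (exists p, runs U p y x /\ length p = n) /\
  (forall p, runs U p y x -> n <= length p).

Definition Kc (U : prcode) (x y : bstring) : nat :=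
  epsilon (inhabits 0) (fun n => is_Kc U x y n).

Definition K (U : prcode) (x : bstring) : nat := Kc U x [].

Definition E (U : prcode) (x y : bstring) : nat := Nat.max (Kc U x y) (Kc U y x).

Local Open Scope Q_scope.
Definition NID (U : prcode) (z : bstring * bstring) : Q :=
  inject_Z (Z.of_nat (E U (fst z) (snd z))) /
  inject_Z (Z.of_nat (Nat.max (K U (fst z)) (K U (snd z)))).

Local Open Scope Q_scope.
Definition computable_approx (f : bstring * bstring -> nat -> Q) : Prop :=
  exists c : prcode, forall x y s, evalR c [enc x; enc y; s] (encQ (f (x, y) s)).

Definition converges (a : nat -> Q) (l : Q) : Prop :=
  forall eps : Q, 0 < eps -> exists s0, forall t, (s0 <= t)%nat -> Qabs (a t - l) < eps.

Fixpoint SigmaSeq (n : nat) (a : nat -> Q) : Prop :=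
  match n with
  | O => False
  | S O => forall t, a t <= a (S t)
  | S m => exists s, (forall t, (S t < s)%nat -> a t <= a (S t)) /\
                     PiSeq m (fun t => a (s + t)%nat)
  end
with PiSeq (n : nat) (a : nat -> Q) : Prop :=
  match n with
  | O => False
  | S O => forall t, a (S t) <= a t
  | S m => exists s, (forall t, (S t < s)%nat -> a (S t) <= a t) /\
                     SigmaSeq m (fun t => a (s + t)%nat)
  end.

Definition InSigma (n : nat) (F : bstring * bstring -> Q) : Prop :=
  exists f, computable_approx f /\
    (forall z, converges (f z) (F z)) /\
    (forall z, SigmaSeq n (f z)).

(* Main.v *)
Require Import Defs.
From Stdlib Require Import List Arith ZArith QArith Qabs Lia Lqa ClassicalEpsilon.
Import ListNotations.
Local Open Scope nat_scope.

(** Oscillations are forced by compressing ever smaller families of pairs [(x, y)].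
    Take [x] with [8n] bits and [y = (y1, y2)] with [3n + n] bits, where [n = 100 k] and [k]
    exceeds the constants of finitely many machines. Initially almost every [K(x|y)] exceeds
    [7n], so NID is at least about 7/8 and the approximation must rise above 5/6 on most
    pairs. Once it has done so, [y1] is made to determine the first [3n] bits of [x] up to a
    common rotation, chosen by averaging so that enough of these pairs have risen for all [y2].
    Now [K(x|y) <= 5n], while [K(x)] is about [8n] for most [x]: NID is about 5/8, and the
    approximation must fall. When it has fallen often enough for one [y1], the [x] in its block
    get descriptions of length [5n], which lifts NID to about 1. When the approximation has
    risen again, [y2] is made to determine [n] more bits of [x], so NID drops to about 4/5.
    The approximation thus goes high, low, high, low, which no up-down-up sequence does. *)

(** * Bounded sums *)

Fixpoint nsum (N : nat) (g : nat -> nat) : nat :=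
  match N with 0 => 0 | S N' => nsum N' g + g N' end.

Definition cnt (N : nat) (P : nat -> bool) : nat := nsum N (fun i => Nat.b2n (P i)).
Definition bex (N : nat) (P : nat -> bool) : bool := 0 <? cnt N P.
Definition ball (N : nat) (P : nat -> bool) : bool := negb (bex N (fun i => negb (P i))).
(* The least [i < N] with [P i], or [N] if there is none. *)
Definition bmin (N : nat) (P : nat -> bool) : nat := cnt N (fun i => negb (bex (S i) P)).

Lemma nsum_le N g h : (forall i, i < N -> g i <= h i) -> nsum N g <= nsum N h.
Proof.
  induction N as [|N IH]; simpl; intros H; [lia|].
  specialize (IH (fun i Hi => H i (Nat.lt_lt_succ_r _ _ Hi))).
  specialize (H N (Nat.lt_succ_diag_r N)). lia.
Qed.

Lemma nsum_ext N g h : (forall i, i < N -> g i = h i) -> nsum N g = nsum N h.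
Proof.
  intros H. apply Nat.le_antisymm; apply nsum_le; intros i Hi; rewrite (H i Hi); lia.
Qed.

Lemma nsum_add N g h : nsum N (fun i => g i + h i) = nsum N g + nsum N h.
Proof. induction N as [|N IH]; simpl; [|rewrite IH]; lia. Qed.

Lemma nsum_const N c : nsum N (fun _ => c) = N * c.
Proof. induction N as [|N IH]; simpl; [|rewrite IH]; lia. Qed.

Lemma nsum_split a b g : nsum (a + b) g = nsum a g + nsum b (fun i => g (a + i)).
Proof.
  induction b as [|b IH]; [rewrite Nat.add_0_r; simpl; lia|].
  rewrite Nat.add_succ_r. simpl. rewrite IH. lia.
Qed.

Lemma nsum_swap N N' g :
  nsum N (fun i => nsum N' (fun j => g i j)) = nsum N' (fun j => nsum N (fun i => g i j)).
Proof.
  induction N as [|N IH]; simpl; [rewrite nsum_const; lia|].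
  rewrite IH, <- nsum_add. reflexivity.
Qed.

Lemma nsum_mul N R g :
  nsum (N * R) g = nsum N (fun b => nsum R (fun r => g (b * R + r))).
Proof.
  induction N as [|N IH]; simpl; [reflexivity|].
  rewrite (Nat.add_comm R), nsum_split, IH. reflexivity.
Qed.

Lemma nsum_rotate M w g : nsum M (fun y => g ((y + w) mod M)) = nsum M g.
Proof.
  destruct (Nat.eq_dec M 0) as [->|HM]; [reflexivity|].
  pose proof (Nat.mod_upper_bound w M HM) as Hlt. set (b := w mod M) in *.
  rewrite (nsum_ext M _ (fun y => g ((y + b) mod M)))
    by (intros; unfold b; rewrite Nat.Div0.add_mod_idemp_r; reflexivity).
  (* The first [M - b] indices are shifted without wrapping; the last [b] wrap around to the
     start. *)
  transitivity (nsum ((M - b) + b) (fun y => g ((y + b) mod M))); [f_equal; lia|].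
  rewrite nsum_split.
  transitivity (nsum (b + (M - b)) g); [|f_equal; lia]. rewrite nsum_split, Nat.add_comm.
  f_equal; apply nsum_ext; intros i Hi; f_equal.
  - replace (M - b + i + b) with (i + 1 * M) by lia.
    rewrite Nat.Div0.mod_add. apply Nat.mod_small. lia.
  - rewrite Nat.mod_small; lia.
Qed.

Lemma nsum_pigeonhole M T F : 0 < M -> M * T <= nsum M F -> exists i, i < M /\ T <= F i.
Proof.
  intros HM H. destruct (excluded_middle_informative (exists i, i < M /\ T <= F i)) as [E|E]; [exact E|].
  exfalso.
  assert (Hle : nsum M (fun i => F i + 1) <= nsum M (fun _ => T)).
  { apply nsum_le. intros i Hi. destruct (le_lt_dec T (F i)); [|lia].
    exfalso; apply E; exists i; auto. }
  rewrite nsum_add, !nsum_const in Hle. lia.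
Qed.

(* Averaging over all rotations of the index set. *)
Lemma exists_rotation M T (h : nat -> nat -> nat) :
  0 < M -> (forall y, y < M -> T <= nsum M (h y)) ->
  exists w, w < M /\ T <= nsum M (fun y => h y ((y + w) mod M)).
Proof.
  intros HM H. apply nsum_pigeonhole; [exact HM|].
  rewrite nsum_swap, <- (nsum_const M T). apply nsum_le. intros y Hy.
  rewrite (nsum_ext M _ (fun w => h y ((w + y) mod M))) by (intros; rewrite Nat.add_comm; reflexivity).
  rewrite (nsum_rotate M y (h y)). auto.
Qed.

Lemma bex_spec N P : bex N P = true <-> exists i, i < N /\ P i = true.
Proof.
  unfold bex, cnt. rewrite Nat.ltb_lt. induction N as [|N IH]; simpl.
  - split; [lia|]. intros [i [Hi _]]; lia.
  - split.
    + intros H. destruct (P N) eqn:E; [exists N; auto|]. simpl in H.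
      destruct (proj1 IH) as [i [Hi Pi]]; [lia|]. exists i; auto.
    + intros [i [Hi Pi]]. destruct (Nat.eq_dec i N) as [->|]; [rewrite Pi; simpl; lia|].
      assert (0 < nsum N (fun i => Nat.b2n (P i))); [|lia].
      apply IH; exists i; split; [lia|auto].
Qed.

Lemma ball_spec N P : ball N P = true <-> forall i, i < N -> P i = true.
Proof.
  unfold ball. rewrite Bool.negb_true_iff, <- Bool.not_true_iff_false, bex_spec. split.
  - intros H i Hi. destruct (P i) eqn:E; [reflexivity|].
    exfalso; apply H; exists i; rewrite E; auto.
  - intros H [i [Hi Pi]]. rewrite (H i Hi) in Pi. discriminate.
Qed.

(** The indices with no witness at or below them are exactly those before the first witness, so
    counting them returns it. *)
Lemma bmin_eq N P i :
  i < N -> P i = true -> (forall j, j < i -> P j = false) -> bmin N P = i.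
Proof.
  intros Hi Pi Hj. unfold bmin, cnt.
  replace N with (i + (N - i)) by lia. rewrite nsum_split.
  rewrite (nsum_ext i _ (fun _ => 1)), (nsum_ext (N - i) _ (fun _ => 0)), !nsum_const; [lia| |].
  - intros j _. replace (bex (S (i + j)) P) with true; [reflexivity|].
    symmetry; apply bex_spec; exists i; split; [lia|auto].
  - intros j Hlt. replace (bex (S j) P) with false; [reflexivity|].
    symmetry; apply Bool.not_true_iff_false; rewrite bex_spec. intros [l [Hl Pl]].
    rewrite Hj in Pl; [discriminate|lia].
Qed.

Lemma cnt_le N P Q : (forall i, i < N -> P i = true -> Q i = true) -> cnt N P <= cnt N Q.
Proof.
  intros H. apply nsum_le. intros i Hi. specialize (H i Hi).
  destruct (P i); simpl; [rewrite H by reflexivity; simpl; lia|lia].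
Qed.

(** Union bound, used to discard the exceptional strings of many conditions at once. *)
Lemma cnt_bex_le N N' P : cnt N (fun i => bex N' (P i)) <= nsum N' (fun j => cnt N (fun i => P i j)).
Proof.
  unfold cnt at 2. rewrite nsum_swap. apply nsum_le. intros i _. fold (cnt N' (P i)).
  unfold bex. destruct (Nat.ltb_spec 0 (cnt N' (P i))); simpl; lia.
Qed.

Lemma cnt_negb N P : cnt N P + cnt N (fun i => negb (P i)) = N.
Proof.
  unfold cnt. rewrite <- nsum_add, (nsum_ext N _ (fun _ => 1)); [rewrite nsum_const; lia|].
  intros i _; destruct (P i); reflexivity.
Qed.

Lemma cnt_le_andb N P Q : cnt N P <= cnt N (fun i => P i && negb (Q i))%bool + cnt N Q.
Proof.
  unfold cnt. rewrite <- nsum_add. apply nsum_le. intros i _.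
  destruct (P i), (Q i); simpl; lia.
Qed.

Lemma cnt_filter N P : cnt N P = length (filter P (seq 0 N)).
Proof.
  unfold cnt. induction N as [|N IH]; [reflexivity|].
  rewrite seq_S, filter_app, length_app, <- IH. simpl. destruct (P N); reflexivity.
Qed.

Lemma least_witness (P : nat -> Prop) :
  (exists n, P n) -> exists n, P n /\ forall j, P j -> n <= j.
Proof.
  intros [n Hn]. revert Hn. induction n as [n IH] using (well_founded_induction lt_wf). intros Hn.
  destruct (excluded_middle_informative (exists j, j < n /\ P j)) as [[j [Hj Pj]]|N]; [eauto|].
  exists n; split; [exact Hn|]. intros j Pj. destruct (le_lt_dec n j); [assumption|].
  exfalso; apply N; eauto.
Qed.

Lemma least_witness_bool (P : nat -> bool) :
  (exists n, P n = true) -> exists n, P n = true /\ forall j, j < n -> P j = false.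
Proof.
  intros H. destruct (least_witness _ H) as [n [Hn Hmin]]. exists n; split; [exact Hn|].
  intros j Hj. destruct (P j) eqn:E; [|reflexivity]. specialize (Hmin j E). lia.
Qed.

Lemma eventually_bounded (N : nat) (Q : nat -> nat -> Prop) :
  (forall i, i < N -> exists s, forall t, s <= t -> Q i t) ->
  exists s, forall t, s <= t -> forall i, i < N -> Q i t.
Proof.
  induction N as [|N IH]; intros H; [exists 0; intros; lia|].
  destruct IH as [s1 H1]; [auto|]. destruct (H N) as [s2 H2]; [lia|].
  exists (Nat.max s1 s2). intros t Ht i Hi.
  destruct (Nat.eq_dec i N) as [->|]; [apply H2|apply H1]; lia.
Qed.

(** * Evaluation of codes *)

(** The recursion is on the derivation itself, since the subderivations for [PComp] sit inside a
    [Forall2] and those for [PMu] under an existential. *)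
Fixpoint evalR_det c xs y (H : evalR c xs y) {struct H} : forall y', evalR c xs y' -> y = y'.
Proof.
  destruct H as [xs|x xs|i xs|f gs xs zs y Hgs Hf|f g xs y Hf|f g n xs r y Hr Hg|f xs n H0 Hlt];
    intros y' H'; inversion H'; subst; try reflexivity.
  - match goal with Hz : Forall2 _ gs ?l |- _ => assert (E : zs = l) end.
    { clear Hf H'. match goal with Hz : Forall2 _ gs ?l, Hl : evalR f ?l _ |- _ => clear Hl; revert l Hz end.
      induction Hgs as [|g z gs zs Hg Hgs IH]; intros l Hz; inversion Hz; subst; [reflexivity|].
      f_equal; [eapply evalR_det; eassumption|auto]. }
    subst. eapply evalR_det; eassumption.
  - eapply evalR_det; eassumption.
  - match goal with Hz : evalR (PRec f g) _ ?q, Hy : evalR g (_ :: ?q :: _) y' |- _ =>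
      assert (E : r = q) by (eapply evalR_det; eassumption) end.
    subst. eapply evalR_det; eassumption.
  - destruct (lt_eq_lt_dec n y') as [[L| ->]|L]; [|reflexivity|].
    + match goal with Hz : forall m, m < y' -> _ |- _ => destruct (Hz n L) as [k Hk] end.
      specialize (evalR_det _ _ _ H0 _ Hk). discriminate.
    + destruct (Hlt y' L) as [k Hk].
      match goal with Hz : evalR f (y' :: xs) 0 |- _ => specialize (evalR_det _ _ _ Hk _ Hz) end.
      discriminate.
Qed.

(* An environment assigns a value to each variable; a code of arity [k] receives the first [k]. *)
Definition comp (k : nat) (F : (nat -> nat) -> nat) : Prop :=
  exists c, forall e, evalR c (map e (seq 0 k)) (F e).
Definition compb (k : nat) (P : (nat -> nat) -> bool) : Prop := comp k (fun e => Nat.b2n (P e)).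

Definition comp1 (F : nat -> nat) : Prop := comp 1 (fun e => F (e 0)).
Definition comp2 (F : nat -> nat -> nat) : Prop := comp 2 (fun e => F (e 0) (e 1)).
Definition comp3 (F : nat -> nat -> nat -> nat) : Prop := comp 3 (fun e => F (e 0) (e 1) (e 2)).
Definition comp4 (F : nat -> nat -> nat -> nat -> nat) : Prop :=
  comp 4 (fun e => F (e 0) (e 1) (e 2) (e 3)).
Definition compb1 (P : nat -> bool) : Prop := comp1 (fun a => Nat.b2n (P a)).
Definition compb2 (P : nat -> nat -> bool) : Prop := comp2 (fun a b => Nat.b2n (P a b)).
Definition compb3 (P : nat -> nat -> nat -> bool) : Prop := comp3 (fun a b c => Nat.b2n (P a b c)).

Lemma comp_ext k F G : (forall e, F e = G e) -> comp k F -> comp k G.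
Proof. intros H [c Hc]. exists c. intros e. rewrite <- H. apply Hc. Qed.

Lemma comp_var k i : i < k -> comp k (fun e => e i).
Proof.
  intros H. exists (PProj i). intros e.
  replace (e i) with (nth i (map e (seq 0 k)) 0); [apply ev_proj|].
  rewrite (nth_indep _ 0 (e 0)) by (rewrite length_map, length_seq; lia).
  rewrite map_nth, seq_nth by lia. reflexivity.
Qed.

Lemma comp_S k F : comp k F -> comp k (fun e => S (F e)).
Proof.
  intros [c Hc]. exists (PComp PSucc [c]). intros e.
  apply ev_comp with (zs := [F e]); [repeat constructor; apply Hc|constructor].
Qed.

Lemma comp_const k n : comp k (fun _ => n).
Proof. induction n; [exists PZero; intros; constructor|apply comp_S; assumption]. Qed.

Lemma comp_subst j k F a :
  comp j F -> (forall i, i < j -> comp k (a i)) -> comp k (fun e => F (fun i => a i e)).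
Proof.
  intros [c Hc] Ha.
  assert (Hcs : exists cs, forall e,
    Forall2 (fun g z => evalR g (map e (seq 0 k)) z) cs (map (fun i => a i e) (seq 0 j))).
  { clear Hc. induction j as [|j IH]; [exists []; constructor|].
    destruct IH as [cs Hcs]; [auto|]. destruct (Ha j) as [cj Hj]; [lia|].
    exists (cs ++ [cj]). intros e. rewrite seq_S, map_app.
    apply Forall2_app; [apply Hcs|]. repeat constructor. apply Hj. }
  destruct Hcs as [cs Hcs]. exists (PComp c cs). intros e.
  eapply ev_comp; [apply Hcs|]. apply (Hc (fun i => a i e)).
Qed.

Lemma comp_ap1 k F a : comp1 F -> comp k a -> comp k (fun e => F (a e)).
Proof. intros HF Ha. apply (comp_subst 1 k _ (fun _ => a) HF). auto. Qed.

Lemma comp_ap2 k F a b :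
  comp2 F -> comp k a -> comp k b -> comp k (fun e => F (a e) (b e)).
Proof.
  intros HF Ha Hb. apply (comp_subst 2 k _ (fun i => match i with 0 => a | _ => b end) HF).
  intros [|i] _; assumption.
Qed.

Lemma comp_ap3 k F a b c :
  comp3 F -> comp k a -> comp k b -> comp k c ->
  comp k (fun e => F (a e) (b e) (c e)).
Proof.
  intros HF Ha Hb Hc.
  apply (comp_subst 3 k _ (fun i => match i with 0 => a | 1 => b | _ => c end) HF).
  intros [|[|i]] _; assumption.
Qed.

Lemma comp_ap4 k F a b c d :
  comp4 F -> comp k a -> comp k b -> comp k c -> comp k d ->
  comp k (fun e => F (a e) (b e) (c e) (d e)).
Proof.
  intros HF Ha Hb Hc Hd.
  apply (comp_subst 4 k _ (fun i => match i with 0 => a | 1 => b | 2 => c | _ => d end) HF).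
  intros [|[|[|i]]] _; assumption.
Qed.

(** Following the argument order of [PRec], the body sees the counter as variable 0, the previous
    value as variable 1, and the ambient variables shifted by two. *)
Lemma comp_rec k a n g :
  comp k a -> comp k n -> comp (S (S k)) (fun e => g (e 0) (e 1) (fun i => e (S (S i)))) ->
  comp k (fun e => nat_rect (fun _ => nat) (a e) (fun i r => g i r e) (n e)).
Proof.
  intros [ca Ha] [cn Hn] [cg Hg].
  exists (PComp (PRec ca cg) (cn :: map PProj (seq 0 k))). intros e.
  apply ev_comp with (zs := n e :: map e (seq 0 k)).
  - constructor; [apply Hn|].
    assert (Hp : forall i, i < k -> evalR (PProj i) (map e (seq 0 k)) (e i)).
    { intros i Hi. replace (e i) with (nth i (map e (seq 0 k)) 0); [apply ev_proj|].
      rewrite (nth_indep _ 0 (e 0)) by (rewrite length_map, length_seq; lia).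
      rewrite map_nth, seq_nth by lia. reflexivity. }
    generalize (fun i => proj1 (in_seq k 0 i)). generalize (seq 0 k) at 1 3 4.
    intros l Hl. induction l as [|i l IH]; simpl; constructor.
    + apply Hp. apply Hl. left; reflexivity.
    + apply IH. intros j Hj. apply Hl. right; exact Hj.
  - induction (n e) as [|m IH]; simpl; [apply ev_rec0, Ha|].
    eapply ev_recS; [exact IH|].
    specialize (Hg (fun j => match j with
      | 0 => m
      | 1 => nat_rect (fun _ => nat) (a e) (fun i r => g i r e) m
      | S (S j) => e j end)).
    simpl in Hg. rewrite <- !seq_shift, !map_map in Hg. exact Hg.
Qed.

Lemma comp_pred k a : comp k a -> comp k (fun e => Nat.pred (a e)).
Proof.
  apply comp_ap1. unfold comp1. apply comp_ext with
    (F := fun e => nat_rect (fun _ => nat) 0 (fun i _ => i) (e 0)).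
  { intros e. destruct (e 0); reflexivity. }
  apply (comp_rec 1 (fun _ => 0) (fun e => e 0) (fun i _ _ => i));
    [apply comp_const|apply comp_var; lia|apply comp_var; lia].
Qed.

Lemma comp_add k a b : comp k a -> comp k b -> comp k (fun e => a e + b e).
Proof.
  apply comp_ap2. unfold comp2. apply comp_ext with
    (F := fun e => nat_rect (fun _ => nat) (e 1) (fun _ r => S r) (e 0)).
  { intros e. induction (e 0); simpl; auto. }
  apply (comp_rec 2 (fun e => e 1) (fun e => e 0) (fun _ r _ => S r));
    [apply comp_var; lia|apply comp_var; lia|apply comp_S, comp_var; lia].
Qed.

Lemma comp_mul k a b : comp k a -> comp k b -> comp k (fun e => a e * b e).
Proof.
  apply comp_ap2. unfold comp2. apply comp_ext with
    (F := fun e => nat_rect (fun _ => nat) 0 (fun _ r => e 1 + r) (e 0)).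
  { intros e. induction (e 0); simpl; auto. }
  apply (comp_rec 2 (fun _ => 0) (fun e => e 0) (fun _ r e => e 1 + r));
    [apply comp_const|apply comp_var; lia|apply comp_add; apply comp_var; lia].
Qed.

Lemma comp_sub k a b : comp k a -> comp k b -> comp k (fun e => a e - b e).
Proof.
  apply comp_ap2. unfold comp2. apply comp_ext with
    (F := fun e => nat_rect (fun _ => nat) (e 0) (fun _ r => Nat.pred r) (e 1)).
  { intros e. induction (e 1) as [|n IH]; simpl; [lia|rewrite IH; lia]. }
  apply (comp_rec 2 (fun e => e 0) (fun e => e 1) (fun _ r _ => Nat.pred r));
    [apply comp_var; lia|apply comp_var; lia|apply comp_pred, comp_var; lia].
Qed.

Lemma comp_pow2 k a : comp k a -> comp k (fun e => 2 ^ a e).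
Proof.
  apply comp_ap1. unfold comp1. apply comp_ext with
    (F := fun e => nat_rect (fun _ => nat) 1 (fun _ r => 2 * r) (e 0)).
  { intros e. induction (e 0) as [|n IH]; simpl in *; [reflexivity|rewrite IH; reflexivity]. }
  apply (comp_rec 1 (fun _ => 1) (fun e => e 0) (fun _ r _ => 2 * r));
    [apply comp_const|apply comp_var; lia|apply comp_mul; [apply comp_const|apply comp_var; lia]].
Qed.

Lemma comp_nsum k N g :
  comp k N -> comp (S k) (fun e => g (e 0) (fun i => e (S i))) ->
  comp k (fun e => nsum (N e) (fun i => g i e)).
Proof.
  intros HN Hg. apply comp_ext with
    (F := fun e => nat_rect (fun _ => nat) 0 (fun i r => r + g i e) (N e)).
  { intros e. induction (N e) as [|n IH]; simpl; [reflexivity|rewrite IH; reflexivity]. }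
  apply (comp_rec k (fun _ => 0) N (fun i r e => r + g i e));
    [apply comp_const|exact HN|].
  apply comp_add; [apply comp_var; lia|].
  (* The summand does not see the accumulator, so the renaming skips variable 1. *)
  apply (comp_subst (S k) (S (S k)) _ (fun i e => match i with 0 => e 0 | S i => e (S (S i)) end) Hg).
  intros [|i] Hi; apply comp_var; lia.
Qed.

Lemma compb_leb k a b : comp k a -> comp k b -> compb k (fun e => a e <=? b e).
Proof.
  intros Ha Hb. apply comp_ext with (F := fun e => 1 - (a e - b e)).
  { intros e. destruct (Nat.leb_spec (a e) (b e)); unfold Nat.b2n; lia. }
  auto using comp_sub, comp_const.
Qed.

Lemma compb_ltb k a b : comp k a -> comp k b -> compb k (fun e => a e <? b e).
Proof. intros Ha Hb. apply compb_leb; auto using comp_S. Qed.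

Lemma compb_negb k P : compb k P -> compb k (fun e => negb (P e)).
Proof.
  intros HP. apply comp_ext with (F := fun e => 1 - Nat.b2n (P e)).
  { intros e. destruct (P e); reflexivity. }
  apply comp_sub; [apply comp_const|exact HP].
Qed.

Lemma compb_andb k P Q : compb k P -> compb k Q -> compb k (fun e => P e && Q e)%bool.
Proof.
  intros HP HQ. apply comp_ext with (F := fun e => Nat.b2n (P e) * Nat.b2n (Q e)).
  { intros e. destruct (P e), (Q e); reflexivity. }
  apply comp_mul; assumption.
Qed.

Lemma compb_eqb k a b : comp k a -> comp k b -> compb k (fun e => a e =? b e).
Proof.
  intros Ha Hb. apply comp_ext with (F := fun e => Nat.b2n ((a e <=? b e) && (b e <=? a e))%bool).
  { intros e. destruct (Nat.eqb_spec (a e) (b e)), (Nat.leb_spec (a e) (b e)),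
      (Nat.leb_spec (b e) (a e)); simpl; lia. }
  apply compb_andb; apply compb_leb; assumption.
Qed.

Lemma compb_xorb k P Q : compb k P -> compb k Q -> compb k (fun e => xorb (P e) (Q e)).
Proof.
  intros HP HQ. apply comp_ext with
    (F := fun e => Nat.b2n (negb (Nat.b2n (P e) =? Nat.b2n (Q e)))).
  { intros e. destruct (P e), (Q e); reflexivity. }
  apply compb_negb, compb_eqb; assumption.
Qed.

Lemma comp_cnt k N P :
  comp k N -> compb (S k) (fun e => P (e 0) (fun i => e (S i))) ->
  comp k (fun e => cnt (N e) (fun i => P i e)).
Proof. intros HN HP. apply (comp_nsum k N (fun i e => Nat.b2n (P i e))); assumption. Qed.

Lemma compb_bex k N P :
  comp k N -> compb (S k) (fun e => P (e 0) (fun i => e (S i))) ->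
  compb k (fun e => bex (N e) (fun i => P i e)).
Proof. intros HN HP. apply compb_ltb; [apply comp_const|apply comp_cnt; assumption]. Qed.

Lemma compb_ball k N P :
  comp k N -> compb (S k) (fun e => P (e 0) (fun i => e (S i))) ->
  compb k (fun e => ball (N e) (fun i => P i e)).
Proof.
  intros HN HP. apply compb_negb.
  apply (compb_bex k N (fun i e => negb (P i e))); [assumption|]. apply compb_negb; assumption.
Qed.

Lemma comp_bmin k N P :
  comp k N -> compb (S k) (fun e => P (e 0) (fun i => e (S i))) ->
  comp k (fun e => bmin (N e) (fun i => P i e)).
Proof.
  intros HN HP. apply (comp_cnt k N (fun i e => negb (bex (S i) (fun j => P j e)))); [assumption|].
  apply compb_negb.
  apply (compb_bex (S k) (fun e => S (e 0)) (fun j e => P j (fun i => e (S i))));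
    [apply comp_S, comp_var; lia|].
  apply (comp_subst (S k) (S (S k)) _ (fun i e => match i with 0 => e 0 | S i => e (S (S i)) end) HP).
  intros [|i] Hi; apply comp_var; lia.
Qed.

(** The quotient is the number of positive multiples of [b] up to [a], which reduces division to
    bounded counting. *)
Lemma div_count a b : 0 < b -> a / b = cnt a (fun j => S j * b <=? a).
Proof.
  intros Hb. unfold cnt.
  assert (Hq : a / b <= a) by (apply Nat.Div0.div_le_upper_bound; nia).
  pose proof (Nat.div_mod_eq a b) as Hdm. pose proof (Nat.mod_upper_bound a b ltac:(lia)) as Hm.
  transitivity (nsum (a / b + (a - a / b)) (fun j => Nat.b2n (S j * b <=? a))); [|f_equal; lia].
  rewrite nsum_split, (nsum_ext (a / b) _ (fun _ => 1)), (nsum_ext (a - a / b) _ (fun _ => 0)),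
    !nsum_const; [lia| |].
  - intros i _. destruct (Nat.leb_spec (S (a / b + i) * b) a); [nia|reflexivity].
  - intros i Hi. destruct (Nat.leb_spec (S i * b) a); [reflexivity|nia].
Qed.

Lemma comp_div k a b : (forall e, 0 < b e) -> comp k a -> comp k b -> comp k (fun e => a e / b e).
Proof.
  intros H Ha Hb. apply comp_ext with (F := fun e => cnt (a e) (fun j => S j * b e <=? a e)).
  { intros e. symmetry. apply div_count, H. }
  assert (W : forall c, comp k c -> comp (S k) (fun e => c (fun i => e (S i)))).
  { intros c Hc. apply (comp_subst k (S k) c (fun i e => e (S i)) Hc). intros; apply comp_var; lia. }
  apply (comp_cnt k a (fun j e => S j * b e <=? a e)); [assumption|].
  apply compb_leb; [apply comp_mul; [apply comp_S, comp_var; lia|]|]; apply W; assumption.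
Qed.

Lemma comp_mod k a b : (forall e, 0 < b e) -> comp k a -> comp k b -> comp k (fun e => a e mod b e).
Proof.
  intros H Ha Hb. apply comp_ext with (F := fun e => a e - b e * (a e / b e)).
  { intros e. pose proof (Nat.div_mod_eq (a e) (b e)). lia. }
  auto using comp_sub, comp_mul, comp_div.
Qed.

(** Patterns such as [@?g e i] recover the body under a bounded operator as a function of index and
    environment. Computability of named functions is taken from the hypotheses. *)
Ltac comp_step := cbv beta;
  match goal with
  | |- comp _ (fun e => e _) => apply comp_var; lia
  | |- comp ?k (fun e => Nat.b2n (@?P e)) => change (compb k P)
  | |- comp _ (fun _ => ?n) => apply comp_const
  | |- comp _ (fun _ => S _) => apply comp_S
  | |- comp _ (fun _ => _ + _) => apply comp_add
  | |- comp _ (fun _ => _ * _) => apply comp_mul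
  | |- comp _ (fun _ => _ - _) => apply comp_sub
  | |- comp _ (fun _ => 2 ^ _) => apply comp_pow2
  | |- comp _ (fun _ => _ / _) => apply comp_div
  | |- comp _ (fun _ => _ mod _) => apply comp_mod
  | |- comp _ (fun e => nsum (@?N e) (fun i => @?g e i)) => apply (comp_nsum _ N (fun i e => g e i))
  | |- comp _ (fun e => cnt (@?N e) (fun i => @?g e i)) => apply (comp_cnt _ N (fun i e => g e i))
  | |- comp _ (fun e => bmin (@?N e) (fun i => @?g e i)) => apply (comp_bmin _ N (fun i e => g e i))
  | |- compb _ (fun _ => _ <=? _) => apply compb_leb
  | |- compb _ (fun _ => _ <? _) => apply compb_ltb
  | |- compb _ (fun _ => _ =? _) => apply compb_eqb
  | |- compb _ (fun _ => negb _) => apply compb_negb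
  | |- compb _ (fun _ => andb _ _) => apply compb_andb
  | |- compb _ (fun _ => xorb _ _) => apply compb_xorb
  | |- compb _ (fun e => bex (@?N e) (fun i => @?g e i)) => apply (compb_bex _ N (fun i e => g e i))
  | |- compb _ (fun e => ball (@?N e) (fun i => @?g e i)) => apply (compb_ball _ N (fun i e => g e i))
  | |- 0 < 2 ^ _ => apply Nat.neq_0_lt_0, Nat.pow_nonzero; discriminate
  | |- 0 < S _ => apply Nat.lt_0_succ
  | |- forall _, 0 < _ => intro
  | H : comp1 ?F |- comp _ (fun e => ?F (@?a e)) => apply (comp_ap1 _ F a H)
  | H : comp2 ?F |- comp _ (fun e => ?F (@?a e) (@?b e)) => apply (comp_ap2 _ F a b H)
  | H : comp3 ?F |- comp _ (fun e => ?F (@?a e) (@?b e) (@?c e)) => apply (comp_ap3 _ F a b c H)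
  | H : comp4 ?F |- comp _ (fun e => ?F (@?a e) (@?b e) (@?c e) (@?d e)) =>
      apply (comp_ap4 _ F a b c d H)
  | H : compb1 ?P |- compb _ (fun e => ?P (@?a e)) =>
      apply (comp_ap1 _ (fun u => Nat.b2n (P u)) a H)
  | H : compb2 ?P |- compb _ (fun e => ?P (@?a e) (@?b e)) =>
      apply (comp_ap2 _ (fun u v => Nat.b2n (P u v)) a b H)
  | H : compb3 ?P |- compb _ (fun e => ?P (@?a e) (@?b e) (@?c e)) =>
      apply (comp_ap3 _ (fun u v w => Nat.b2n (P u v w)) a b c H)
  end.
Ltac comp_tac := repeat comp_step.

(** * Strings as numbers *)

Lemma enc_inj s t : enc s = enc t -> s = t.
Proof.
  revert t. induction s as [|b s IH]; intros [|b' t]; simpl; intros H;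
    try (destruct b; lia); try (destruct b'; lia); [reflexivity|].
  assert (b = b') as -> by (destruct b, b'; auto; lia).
  f_equal. apply IH. destruct b'; lia.
Qed.

(** [enc] is bijective base-2 numeration with digits 1 and 2, least significant first; the parity of
    a positive number gives its first digit. *)
Lemma enc_surj n : exists s, enc s = n.
Proof.
  induction n as [n IH] using (well_founded_induction lt_wf).
  destruct (Nat.eq_dec n 0) as [->|Hn]; [exists []; reflexivity|].
  destruct (Nat.Even_or_Odd n) as [[q Hq]|[q Hq]].
  - destruct (IH (q - 1)) as [s Hs]; [lia|]. exists (true :: s). simpl. lia.
  - destruct (IH q) as [s Hs]; [lia|]. exists (false :: s). simpl. lia.
Qed.

Definition dec (n : nat) : bstring := proj1_sig (constructive_indefinite_description _ (enc_surj n)).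

Lemma enc_dec n : enc (dec n) = n.
Proof. unfold dec. destruct (constructive_indefinite_description _ _); assumption. Qed.

Lemma dec_enc s : dec (enc s) = s.
Proof. apply enc_inj, enc_dec. Qed.

Lemma dec_0 : dec 0 = [].
Proof. apply (dec_enc []). Qed.

(** In binary, [enc s + 1] is a leading one above the bits of [s], so its size determines the
    length. *)
Lemma enc_bounds s : 2 ^ length s <= enc s + 1 < 2 ^ S (length s).
Proof. induction s as [|b s IH]; simpl in *; [lia|]. destruct b; lia. Qed.

Lemma length_dec n l : 2 ^ l <= n + 1 < 2 ^ S l -> length (dec n) = l.
Proof.
  intros [H1 H2]. pose proof (enc_bounds (dec n)) as [H3 H4]. rewrite enc_dec in *.
  assert (l < S (length (dec n))) by (apply (Nat.pow_lt_mono_r_iff 2); lia).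
  assert (length (dec n) < S l) by (apply (Nat.pow_lt_mono_r_iff 2); lia).
  lia.
Qed.

Lemma enc_lt_pow s n : length s < n -> enc s + 1 < 2 ^ n.
Proof.
  intros H. pose proof (enc_bounds s). assert (2 ^ S (length s) <= 2 ^ n); [|lia].
  apply Nat.pow_le_mono_r; lia.
Qed.

(** * Machines with self-delimiting programs [1^k 0 w] *)

Definition prog (k : nat) (w : bstring) : bstring := repeat true k ++ false :: w.

(** Turns parsing into an arithmetic equation, which [parses] tests. *)
Lemma enc_prog k w : enc (prog k w) + 2 = 2 ^ k * (2 * enc w + 3).
Proof. unfold prog. induction k as [|k IH]; simpl in *; lia. Qed.

Lemma prog_prefix k w k' w' r : prog k' w' = prog k w ++ r -> k = k' /\ w' = w ++ r.
Proof.
  unfold prog. revert k'. induction k as [|k IH]; intros [|k']; simpl; intros H; try discriminate.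
  - split; congruence.
  - injection H as H. apply IH in H. destruct H; split; congruence.
Qed.

Lemma prog_inj k w k' w' : prog k w = prog k' w' -> k = k' /\ w = w'.
Proof.
  intros H. destruct (prog_prefix k w k' w' []) as [-> ->]; [rewrite app_nil_r; auto|].
  rewrite app_nil_r; auto.
Qed.

Lemma length_prog k w : length (prog k w) = k + 1 + length w.
Proof. unfold prog. rewrite length_app, repeat_length. simpl. lia. Qed.

Definition parses (k v e : nat) : bool := e + 2 =? 2 ^ k * (2 * v + 3).
Definition header (e : nat) : nat := bmin (S e) (fun k => bex (S e) (fun v => parses k v e)).
Definition payload (e : nat) : nat := bmin (S e) (fun v => parses (header e) v e).
(** The header dictates the payload length, which makes the set of accepted programs prefix-free. *)
Definition well_formed (l : nat -> nat) (e : nat) : bool :=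
  (parses (header e) (payload e) e &&
   ((2 ^ l (header e) <=? payload e + 1) && (payload e + 1 <? 2 ^ S (l (header e)))))%bool.

Lemma parses_prog k v e : parses k v e = true <-> dec e = prog k (dec v).
Proof.
  unfold parses. rewrite Nat.eqb_eq. split; intros H.
  - apply enc_inj. rewrite enc_dec. pose proof (enc_prog k (dec v)) as Hp.
    rewrite enc_dec in Hp. lia.
  - rewrite <- (enc_dec e), H, enc_prog, enc_dec. reflexivity.
Qed.

Lemma header_payload_prog k w :
  header (enc (prog k w)) = k /\ payload (enc (prog k w)) = enc w.
Proof.
  set (e := enc (prog k w)).
  assert (Hp : forall k' v, parses k' v e = true <-> k' = k /\ v = enc w).
  { intros k' v. rewrite parses_prog. unfold e. rewrite dec_enc. split.
    - intros H. apply prog_inj in H. destruct H as [-> ->]. rewrite enc_dec. auto.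
    - intros [-> ->]. rewrite dec_enc. reflexivity. }
  assert (Hb : k <= e /\ enc w <= e).
  { pose proof (enc_prog k w) as H. fold e in H. pose proof (Nat.pow_gt_lin_r 2 k). nia. }
  assert (Hh : header e = k).
  { apply bmin_eq; [lia| |].
    - apply bex_spec. exists (enc w). split; [lia|]. apply Hp; auto.
    - intros j Hj. apply Bool.not_true_iff_false. rewrite bex_spec.
      intros [v [_ Hv]]. apply Hp in Hv. lia. }
  split; [exact Hh|]. unfold payload. rewrite Hh.
  apply bmin_eq; [lia|apply Hp; auto|].
  intros j Hj. apply Bool.not_true_iff_false. rewrite Hp. lia.
Qed.

Lemma well_formed_inv l p :
  well_formed l (enc p) = true -> exists k w, p = prog k w /\ length w = l k.
Proof.
  unfold well_formed. rewrite !Bool.andb_true_iff, parses_prog, dec_enc, Nat.leb_le, Nat.ltb_lt.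
  intros [H1 H2]. exists (header (enc p)), (dec (payload (enc p))).
  split; [exact H1|apply length_dec; exact H2].
Qed.

Lemma well_formed_prog l k w : length w = l k -> well_formed l (enc (prog k w)) = true.
Proof.
  intros H. unfold well_formed. destruct (header_payload_prog k w) as [-> ->].
  rewrite !Bool.andb_true_iff, parses_prog, !dec_enc, Nat.leb_le, Nat.ltb_lt, <- H.
  split; [reflexivity|apply enc_bounds].
Qed.

(* The machine reads [k] and [i < 2 ^ l k] off its program, searches for the least stage [s]
   with [P k s], and outputs [O k i y s], where [y] is the condition. *)
Lemma search_machine (l : nat -> nat) (P : nat -> nat -> bool) (O : nat -> nat -> nat -> nat -> nat) :
  comp1 l -> compb2 P -> comp4 O ->
  exists M, prefix_free M /\
    forall k i y s, i < 2 ^ l k -> P k s = true -> (forall j, j < s -> P k j = false) ->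
      exists p, runs M p (dec y) (dec (O k i y s)) /\ length p = l k + k + 1.
Proof.
  intros Hl HP HO.
  assert (Hpar : compb3 parses) by (unfold compb3, comp3, parses; comp_tac).
  assert (Hh : comp1 header) by (unfold comp1, header; comp_tac).
  assert (Hv : comp1 payload) by (unfold comp1, payload; comp_tac).
  assert (Hw : compb1 (well_formed l)) by (unfold compb1, comp1, well_formed; comp_tac).
  (* Negated because [PMu] searches for a zero; on a malformed program no stage passes, so the
     machine diverges. *)
  assert (HT : comp 3 (fun e => Nat.b2n (negb (well_formed l (e 1) && P (header (e 1)) (e 0)))))
    by comp_tac.
  (* The strings of length [l k] have the codes from [2 ^ l k - 1] on, so the offset recovers the
     index [i]. *)
  assert (HR : comp 3 (fun e => O (header (e 1)) (payload (e 1) + 1 - 2 ^ l (header (e 1))) (e 2) (e 0)))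
    by comp_tac.
  destruct HT as [cT HT], HR as [cR HR].
  set (test := fun s e => negb (well_formed l e && P (header e) s)).
  set (res := fun s e y => O (header e) (payload e + 1 - 2 ^ l (header e)) y s).
  assert (HT' : forall s e y, evalR cT [s; e; y] (Nat.b2n (test s e)))
    by (intros s e y; exact (HT (fun i => nth i [s; e; y] 0))).
  assert (HR' : forall s e y, evalR cR [s; e; y] (res s e y))
    by (intros s e y; exact (HR (fun i => nth i [s; e; y] 0))).
  exists (PComp cR [PMu cT; PProj 0; PProj 1]). split.
  - assert (Hdom : forall p y x, runs (PComp cR [PMu cT; PProj 0; PProj 1]) p y x ->
      exists k w, p = prog k w /\ length w = l k).
    { intros p y x H. inversion H as [| | |f gs xs zs z Hzs _| | |]; subst.
      inversion Hzs as [|g s gs' zs' Hs _]; subst.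
      inversion Hs as [| | | | | |f xs n H0 _]; subst.
      apply well_formed_inv.
      pose proof (evalR_det _ _ _ H0 _ (HT' s (enc p) (enc y))) as Ht.
      unfold test in Ht. destruct (well_formed l (enc p)); [reflexivity|discriminate]. }
    (* Comparable accepted programs share the header, hence the payload length, so the extension [r]
       is empty. *)
    intros y p q xp xq Hp Hq [r Hr].
    apply Hdom in Hp. apply Hdom in Hq.
    destruct Hp as [k [w [-> Hw1]]], Hq as [k' [w' [-> Hw2]]].
    apply prog_prefix in Hr. destruct Hr as [-> ->].
    rewrite length_app in Hw2. destruct r; [|simpl in Hw2; lia].
    rewrite app_nil_r. reflexivity.
  - intros k i y s Hi Hs Hj.
    assert (Hw1 : length (dec (i + 2 ^ l k - 1)) = l k) by (apply length_dec; simpl; lia).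
    exists (prog k (dec (i + 2 ^ l k - 1))).
    split; [|rewrite length_prog, Hw1; lia].
    destruct (header_payload_prog k (dec (i + 2 ^ l k - 1))) as [Eh Ev].
    pose proof (well_formed_prog l _ _ Hw1) as Hwf.
    unfold runs. rewrite !enc_dec. rewrite enc_dec in Ev.
    set (e := enc (prog k (dec (i + 2 ^ l k - 1)))) in *.
    assert (Er : res s e y = O k i y s).
    { unfold res. rewrite Eh, Ev. f_equal. lia. }
    rewrite <- Er. apply ev_comp with (zs := [s; e; y]); [|apply HR'].
    constructor; [|constructor; [exact (ev_proj 0 [e; y])|constructor; [exact (ev_proj 1 [e; y])|constructor]]].
    apply ev_mu.
    + pose proof (HT' s e y) as H. unfold test in H. rewrite Hwf, Eh, Hs in H. exact H.
    + intros j Hlt. exists 0. pose proof (HT' j e y) as H.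
      unfold test in H. rewrite Hwf, Eh, (Hj j Hlt) in H. exact H.
Qed.

(** * Complexity of numbers *)

Definition KN (U : prcode) (x y : nat) : nat := Kc U (dec x) (dec y).

(** [Kc] is chosen by [epsilon] and meets its specification only if some program exists; [q] is one,
    so a least length exists. *)
Lemma Kc_le U q x y : runs U q y x -> is_Kc U x y (Kc U x y) /\ Kc U x y <= length q.
Proof.
  intros Hq.
  assert (Hk : is_Kc U x y (Kc U x y)).
  { unfold Kc. apply epsilon_spec.
    destruct (least_witness (fun n => exists p, runs U p y x /\ length p = n)) as [n [Hn Hmin]];
      [eauto|].
    exists n. split; [exact Hn|]. intros p Hp. apply Hmin. eauto. }
  split; [exact Hk|]. apply Hk. exact Hq.
Qed.

(** The term [k] pays for the unary header and [l k] for the payload. The constant [c] is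
    independent of [k], so [k] can later be chosen above it. *)
Lemma KN_search_le U l P O :
  universal_pf U -> comp1 l -> compb2 P -> comp4 O ->
  exists c, forall k i y s, i < 2 ^ l k -> P k s = true -> (forall j, j < s -> P k j = false) ->
    KN U (O k i y s) y <= l k + k + c.
Proof.
  intros [_ HU] Hl HP HO. destruct (search_machine l P O Hl HP HO) as [M [HM Hrun]].
  destruct (HU M HM) as [c Hc]. exists (c + 1). intros k i y s Hi Hs Hj.
  destruct (Hrun k i y s Hi Hs Hj) as [p [Hp Hlen]].
  destruct (Hc _ _ _ Hp) as [q [Hq Hlq]].
  destruct (Kc_le _ _ _ _ Hq) as [_ H]. unfold KN. lia.
Qed.

Lemma is_Kc_KN U : universal_pf U -> forall x y, is_Kc U (dec x) (dec y) (KN U x y).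
Proof.
  intros [_ HU] x y.
  (* A machine printing its payload index gives every number some program: header [x] leaves room
     for index [x], as [x < 2 ^ x]. *)
  destruct (search_machine (fun k => k) (fun _ _ => true) (fun _ i _ _ => i)) as [M [HM Hrun]];
    [unfold comp1; comp_tac|exact (comp_const 2 1)|unfold comp4; comp_tac|].
  destruct (HU M HM) as [c Hc].
  destruct (Hrun x x y 0) as [p [Hp _]]; [apply Nat.pow_gt_lin_r; lia|reflexivity|lia|].
  destruct (Hc _ _ _ Hp) as [q [Hq _]]. apply (Kc_le _ _ _ _ Hq).
Qed.

(** If the empty program halted on condition [y], prefix-freeness would make it the only one to do
    so, and [S x] would have no program. *)
Lemma KN_pos U : universal_pf U -> forall x y, 0 < KN U x y.
Proof.
  intros HU x y. destruct (Nat.eq_dec (KN U x y) 0) as [E|]; [|lia].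
  destruct (is_Kc_KN U HU x y) as [[p [Hp Hlen]] _].
  destruct (is_Kc_KN U HU (S x) y) as [[q [Hq _]] _].
  rewrite E in Hlen. apply length_zero_iff_nil in Hlen. subst p.
  assert (Eq : [] = q) by (eapply (proj1 HU); [exact Hp|exact Hq|exists q; reflexivity]).
  subst q. pose proof (evalR_det _ _ _ Hp _ Hq) as H. rewrite !enc_dec in H. lia.
Qed.

(** Distinct values have distinct shortest programs, and only [2 ^ a - 1] strings are shorter than
    [a]. The injection [g] allows counting inside a family of strings. *)
Lemma KN_count U a g y N :
  universal_pf U -> (forall i j, g i = g j -> i = j) ->
  cnt N (fun i => KN U (g i) y <? a) < 2 ^ a.
Proof.
  intros HU Hg. rewrite cnt_filter. set (L := filter _ _).
  assert (Hprog : forall i, exists e, KN U (g i) y < a -> evalR U [e; y] (g i) /\ e + 1 < 2 ^ a).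
  { intros i. destruct (is_Kc_KN U HU (g i) y) as [[p [Hp Hlen]] _]. exists (enc p). intros Hlt.
    split; [unfold runs in Hp; rewrite !enc_dec in Hp; exact Hp|]. apply enc_lt_pow. lia. }
  set (pc := fun i => proj1_sig (constructive_indefinite_description _ (Hprog i))).
  assert (Hpc : forall i, In i L -> evalR U [pc i; y] (g i) /\ pc i + 1 < 2 ^ a).
  { intros i Hi. apply filter_In in Hi. destruct Hi as [_ Hi]. apply Nat.ltb_lt in Hi.
    unfold pc. destruct (constructive_indefinite_description _ (Hprog i)); auto. }
  assert (HL : length (map pc L) <= length (seq 0 (2 ^ a - 1))).
  { apply NoDup_incl_length.
    - apply NoDup_map_NoDup_ForallPairs; [|apply NoDup_filter, seq_NoDup].
      intros i j Hi Hj E. apply Hg. destruct (Hpc i Hi) as [H1 _], (Hpc j Hj) as [H2 _].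
      rewrite <- E in H2. exact (evalR_det _ _ _ H1 _ H2).
    - intros e He. apply in_map_iff in He. destruct He as [i [<- Hi]].
      apply in_seq. destruct (Hpc i Hi). lia. }
  rewrite length_map, length_seq in HL. pose proof (Nat.pow_nonzero 2 a). lia.
Qed.

(** * Forcing four oscillations *)

Section Forcing.

(* [ph x y s] counts the oscillations of the approximation at [(x, y)] before stage [s]; it is
   even while the approximation is low. *)
Context (U : prcode) (HU : universal_pf U) (ph : nat -> nat -> nat -> nat) (ph_comp : comp3 ph).
(** The arithmetic premises compare NID with 5/6 after clearing denominators: a low phase must end
    where NID is above 5/6, a high one where it is below. *)
Context (ph_up : forall j x y s, Nat.even j = true -> j <= ph x y s ->
  5 * Nat.max (KN U x 0) (KN U y 0) < 6 * Nat.max (KN U x y) (KN U y x) ->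
  exists s', forall t, s' <= t -> S j <= ph x y t).
Context (ph_down : forall j x y s, Nat.even j = false -> j <= ph x y s ->
  6 * Nat.max (KN U x y) (KN U y x) < 5 * Nat.max (KN U x 0) (KN U y 0) ->
  exists s', forall t, s' <= t -> S j <= ph x y t).

(* The searched numbers do double duty: [u] and [w] are at once a stage and a rotation (modulo
   [2 ^ 3n] and [2 ^ n] respectively), and [v] is at once a stage and the chosen [y1]. *)
Definition unit_of (k : nat) : nat := 100 * k.
(** Once the rotation [u] is known, [y1] fixes the upper [3n] bits of [x], and [j] is the lower [5n]
    bits. *)
Definition xof (k u y1 j : nat) : nat :=
  ((y1 + u) mod 2 ^ (3 * unit_of k)) * 2 ^ (5 * unit_of k) + j.
Definition yof (k y1 y2 : nat) : nat := y1 * 2 ^ unit_of k + y2.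

(** A rise is required for every [y2], since [x] is matched with a [y2] only in the third stage. The
    three stages demand the proportions 1/2, 1/4 and 1/8; the losses in between are the compressible
    strings. *)
Definition stage1 (k u : nat) : bool :=
  2 ^ (8 * unit_of k) <=? 2 * nsum (2 ^ (3 * unit_of k)) (fun y1 => cnt (2 ^ (5 * unit_of k)) (fun j =>
    ball (2 ^ unit_of k) (fun y2 => 1 <=? ph (xof k u y1 j) (yof k y1 y2) u))).

(** Recovers the first rotation from a later stage, so that a machine that has found [v] can rebuild
    the block. *)
Definition shift1 (k v : nat) : nat := bmin v (stage1 k).
Definition row2 (k v : nat) : nat := v mod 2 ^ (3 * unit_of k).
Definition x2of (k v j : nat) : nat := xof k (shift1 k v) (row2 k v) j.

Definition stage2 (k v : nat) : bool :=
  (bex v (stage1 k) &&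
   (2 ^ (5 * unit_of k) <=? 4 * cnt (2 ^ (5 * unit_of k)) (fun j =>
     ball (2 ^ unit_of k) (fun y2 => 2 <=? ph (x2of k v j) (yof k (row2 k v) y2) v))))%bool.

Definition time2 (k w : nat) : nat := bmin w (stage2 k).
(** Inside the chosen block, [y2] fixes [n] further bits of [x] up to a rotation and leaves [4n]
    bits free. *)
Definition x3of (k w y2 r : nat) : nat :=
  x2of k (time2 k w) (((y2 + w) mod 2 ^ unit_of k) * 2 ^ (4 * unit_of k) + r).

Definition stage3 (k w : nat) : bool :=
  (bex w (stage2 k) &&
   (2 ^ (5 * unit_of k) <=? 8 * nsum (2 ^ unit_of k) (fun y2 => cnt (2 ^ (4 * unit_of k)) (fun r =>
     3 <=? ph (x3of k w y2 r) (yof k (row2 k (time2 k w)) y2) w))))%bool.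

(** * Computability of the construction *)

Lemma unit_of_comp : comp1 unit_of.
Proof. unfold comp1, unit_of. comp_tac. Qed.

Lemma xof_comp : comp4 xof.
Proof. pose proof unit_of_comp. unfold comp4, xof. comp_tac. Qed.

Lemma yof_comp : comp3 yof.
Proof. pose proof unit_of_comp. unfold comp3, yof. comp_tac. Qed.

Lemma stage1_comp : compb2 stage1.
Proof.
  pose proof unit_of_comp. pose proof xof_comp. pose proof yof_comp.
  unfold compb2, comp2, stage1. comp_tac.
Qed.

Lemma shift1_comp : comp2 shift1.
Proof.
  pose proof stage1_comp. unfold comp2, shift1.
  apply (comp_bmin 2 (fun e => e 1) (fun i e => stage1 (e 0) i)); comp_tac.
Qed.

Lemma row2_comp : comp2 row2.
Proof. pose proof unit_of_comp. unfold comp2, row2. comp_tac. Qed.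

Lemma x2of_comp : comp3 x2of.
Proof.
  pose proof xof_comp. pose proof shift1_comp. pose proof row2_comp.
  unfold comp3, x2of. comp_tac.
Qed.

Lemma stage2_comp : compb2 stage2.
Proof.
  pose proof unit_of_comp. pose proof x2of_comp. pose proof yof_comp. pose proof row2_comp.
  pose proof stage1_comp.
  unfold compb2, comp2, stage2.
  apply (compb_andb 2 (fun e => bex (e 1) (stage1 (e 0)))); [|comp_tac].
  apply (compb_bex 2 (fun e => e 1) (fun i e => stage1 (e 0) i)); comp_tac.
Qed.

Lemma time2_comp : comp2 time2.
Proof.
  pose proof stage2_comp. unfold comp2, time2.
  apply (comp_bmin 2 (fun e => e 1) (fun i e => stage2 (e 0) i)); comp_tac.
Qed.

Lemma x3of_comp : comp4 x3of.
Proof.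
  pose proof unit_of_comp. pose proof x2of_comp. pose proof time2_comp.
  unfold comp4, x3of. comp_tac.
Qed.

Lemma stage3_comp : compb2 stage3.
Proof.
  pose proof unit_of_comp. pose proof x3of_comp. pose proof yof_comp. pose proof row2_comp.
  pose proof stage2_comp. pose proof time2_comp.
  unfold compb2, comp2, stage3.
  apply (compb_andb 2 (fun e => bex (e 1) (stage2 (e 0)))); [|comp_tac].
  apply (compb_bex 2 (fun e => e 1) (fun i e => stage2 (e 0) i)); comp_tac.
Qed.

Lemma pow2_pos a : 0 < 2 ^ a.
Proof. apply Nat.neq_0_lt_0, Nat.pow_nonzero. discriminate. Qed.

Lemma pow2_split a b c : a = b + c -> 2 ^ a = 2 ^ b * 2 ^ c.
Proof. intros ->. apply Nat.pow_add_r. Qed.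

(** * Each stage is reached *)

Section Stages.

Context (k : nat) (k_pos : 0 < k).
Local Notation n := (unit_of k).
(** The slack [2 * k] covers the header of length [k] and a machine constant below [k]. *)
Context (K_x : forall x y, x < 2 ^ (8 * n) -> KN U x y <= 8 * n + 2 * k).
Context (K_y : forall x y, x < 2 ^ (4 * n) -> KN U x y <= 4 * n + 2 * k).

Lemma unit_of_eq : n = 100 * k.
Proof. reflexivity. Qed.

Lemma yof_lt y1 y2 : y1 < 2 ^ (3 * n) -> y2 < 2 ^ n -> yof k y1 y2 < 2 ^ (4 * n).
Proof.
  intros H1 H2. unfold yof. rewrite (pow2_split (4 * n) (3 * n) n) by lia. nia.
Qed.

Lemma stage1_exists : exists u, stage1 k u = true.
Proof.
  pose proof unit_of_eq as En.
  (* Finitely many pairs are involved, so one stage serves them all. The premise of [ph_up] holds as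
     [5 * (8n + 2k) < 6 * (7n - 1)]. *)
  assert (Hev : exists s, forall t, s <= t -> forall x, x < 2 ^ (8 * n) ->
    forall y, y < 2 ^ (4 * n) -> 7 * n - 1 <= KN U x y -> 1 <= ph x y t).
  { apply (eventually_bounded _ (fun x t => forall y, y < 2 ^ (4 * n) ->
      7 * n - 1 <= KN U x y -> 1 <= ph x y t)). intros x Hx.
    apply (eventually_bounded _ (fun y t => 7 * n - 1 <= KN U x y -> 1 <= ph x y t)). intros y Hy.
    destruct (le_lt_dec (7 * n - 1) (KN U x y)) as [HK|HK]; [|exists 0; intros; lia].
    destruct (ph_up 0 x y 0) as [s Hs]; [reflexivity|lia| |exists s; auto].
    pose proof (K_x x 0 Hx). pose proof (K_y y 0 Hy). lia. }
  destruct Hev as [s Hs].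
  pose proof (pow2_pos (3 * n)) as HM.
  pose proof (pow2_split (8 * n) (3 * n) (5 * n) ltac:(lia)) as E8.
  pose proof (pow2_split (8 * n) n (7 * n) ltac:(lia)) as E8'.
  pose proof (pow2_split (7 * n) 1 (7 * n - 1) ltac:(lia)) as E7.
  pose proof (pow2_split (8 * n) 1 (8 * n - 1) ltac:(lia)) as E81.
  change (2 ^ 1) with 2 in *.
  (* [x] stays hard to describe given [y1] together with any [y2]. *)
  set (good := fun y1 x => ball (2 ^ n) (fun y2 => 7 * n - 1 <=? KN U x (yof k y1 y2))).
  destruct (exists_rotation (2 ^ (3 * n)) (2 ^ (8 * n - 1))
    (fun y1 b => cnt (2 ^ (5 * n)) (fun j => good y1 (b * 2 ^ (5 * n) + j)))) as [w [Hw HT]];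
    [exact HM| |].
  { intros y1 _.
    transitivity (cnt (2 ^ (8 * n)) (good y1));
      [|unfold cnt at 1; rewrite E8, nsum_mul; apply le_n].
    pose proof (cnt_negb (2 ^ (8 * n)) (good y1)) as Hc.
    (* Each of the [2 ^ n] conditions has fewer than [2 ^ (7n - 1)] exceptions, in total at most
       half of all [x]. *)
    assert (Hbad : cnt (2 ^ (8 * n)) (fun x => negb (good y1 x)) <= 2 ^ n * 2 ^ (7 * n - 1)).
    { rewrite <- (nsum_const (2 ^ n) (2 ^ (7 * n - 1))).
      eapply Nat.le_trans; [|apply nsum_le; intros y2 _; apply Nat.lt_le_incl;
        apply (KN_count U (7 * n - 1) (fun x => x) (yof k y1 y2) (2 ^ (8 * n)) HU); auto].
      eapply Nat.le_trans; [|apply cnt_bex_le].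
      apply cnt_le. intros x _. unfold good, ball. rewrite Bool.negb_involutive, !bex_spec.
      intros [y2 [Hy2 H]]. exists y2. split; [exact Hy2|].
      apply Nat.ltb_lt. apply Bool.negb_true_iff, Nat.leb_gt in H. exact H. }
    nia. }
  (* A multiple of [2 ^ (3n)] makes the stage late enough without changing the rotation [w]. *)
  exists (s * 2 ^ (3 * n) + w). unfold stage1. apply Nat.leb_le.
  set (u := s * 2 ^ (3 * n) + w). assert (Hu : s <= u) by (unfold u; nia).
  rewrite E81. apply Nat.mul_le_mono_l. eapply Nat.le_trans; [exact HT|].
  apply nsum_le. intros y1 Hy1. apply cnt_le. intros j Hj.
  assert (Ex : xof k u y1 j = (y1 + w) mod 2 ^ (3 * n) * 2 ^ (5 * n) + j).
  { unfold xof, u. do 2 f_equal. replace (y1 + (s * 2 ^ (3 * n) + w)) with (y1 + w + s * 2 ^ (3 * n)) by lia.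
    apply Nat.Div0.mod_add. }
  unfold good. rewrite !ball_spec. intros Hg y2 Hy2. specialize (Hg y2 Hy2).
  apply Nat.leb_le in Hg. apply Nat.leb_le. rewrite Ex.
  apply Hs; [exact Hu| |apply yof_lt; assumption|exact Hg].
  pose proof (Nat.mod_upper_bound (y1 + w) (2 ^ (3 * n)) ltac:(lia)). nia.
Qed.

Lemma stage2_exists u :
  stage1 k u = true -> (forall j, j < u -> stage1 k j = false) ->
  (forall y1 y2 i, y1 < 2 ^ (3 * n) -> y2 < 2 ^ n -> i < 2 ^ (5 * n) ->
    KN U (xof k u y1 i) (yof k y1 y2) <= 5 * n + 2 * k) ->
  exists v, stage2 k v = true.
Proof.
  intros Hu Hmin HK. pose proof unit_of_eq as En.
  pose proof (pow2_pos (3 * n)) as HM.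
  pose proof (pow2_split (8 * n) (3 * n) (5 * n) ltac:(lia)) as E8.
  pose proof (pow2_split (8 * n) 2 (8 * n - 2) ltac:(lia)) as E82.
  pose proof (pow2_split (5 * n) 2 (5 * n - 2) ltac:(lia)) as E52.
  change (2 ^ 2) with 4 in *.
  pose proof Hu as Hc. unfold stage1 in Hc. apply Nat.leb_le in Hc.
  set (G := fun y1 j => ball (2 ^ n) (fun y2 => 1 <=? ph (xof k u y1 j) (yof k y1 y2) u)).
  change (2 ^ (8 * n) <= 2 * nsum (2 ^ (3 * n)) (fun y1 => cnt (2 ^ (5 * n)) (G y1))) in Hc.
  set (L := fun y1 j => KN U (xof k u y1 j) 0 <? 8 * n - 2).
  (* The rotation permutes the blocks, so as [y1] and [j] vary, [x] runs exactly once through the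
     numbers below [2 ^ (8n)]. *)
  assert (HL : nsum (2 ^ (3 * n)) (fun y1 => cnt (2 ^ (5 * n)) (L y1)) < 2 ^ (8 * n - 2)).
  { unfold L, xof.
    rewrite (nsum_rotate (2 ^ (3 * n)) u (fun b => cnt (2 ^ (5 * n)) (fun j =>
      KN U (b * 2 ^ (5 * n) + j) 0 <? 8 * n - 2))).
    unfold cnt. rewrite <- (nsum_mul _ _ (fun x => Nat.b2n (KN U x 0 <? 8 * n - 2))).
    apply (KN_count U (8 * n - 2) (fun x => x) 0); auto. }
  (* Half of the [x] have risen and fewer than a quarter are compressible, so for some [y1] at least
     a quarter of its block is both risen and incompressible. *)
  destruct (nsum_pigeonhole (2 ^ (3 * n)) (2 ^ (5 * n - 2))
    (fun y1 => cnt (2 ^ (5 * n)) (fun j => G y1 j && negb (L y1 j))%bool)) as [y1 [Hy1 HT]];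
    [exact HM| |].
  { assert (H : nsum (2 ^ (3 * n)) (fun y1 => cnt (2 ^ (5 * n)) (G y1)) <=
      nsum (2 ^ (3 * n)) (fun y1 => cnt (2 ^ (5 * n)) (fun j => G y1 j && negb (L y1 j))%bool) +
      nsum (2 ^ (3 * n)) (fun y1 => cnt (2 ^ (5 * n)) (L y1))).
    { rewrite <- nsum_add. apply nsum_le. intros; apply cnt_le_andb. }
    assert (4 * (2 ^ (3 * n) * 2 ^ (5 * n - 2)) = 2 ^ (8 * n)) by (rewrite E8, E52; ring).
    lia. }
  assert (Hev : exists s, forall t, s <= t -> forall j, j < 2 ^ (5 * n) ->
    forall y2, y2 < 2 ^ n -> (G y1 j && negb (L y1 j))%bool = true ->
    2 <= ph (xof k u y1 j) (yof k y1 y2) t).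
  { apply (eventually_bounded _ (fun j t => forall y2, y2 < 2 ^ n ->
      (G y1 j && negb (L y1 j))%bool = true -> 2 <= ph (xof k u y1 j) (yof k y1 y2) t)). intros j Hj.
    apply (eventually_bounded _ (fun y2 t => (G y1 j && negb (L y1 j))%bool = true ->
      2 <= ph (xof k u y1 j) (yof k y1 y2) t)). intros y2 Hy2.
    destruct (G y1 j && negb (L y1 j))%bool eqn:E; [|exists 0; discriminate].
    apply andb_prop in E. destruct E as [HG HnL].
    unfold G in HG. rewrite ball_spec in HG. specialize (HG y2 Hy2). apply Nat.leb_le in HG.
    apply Bool.negb_true_iff, Nat.ltb_ge in HnL.
    destruct (ph_down 1 _ _ u eq_refl HG) as [s Hs]; [|exists s; auto].
    (* The margin is [6 * (5n + 2k) < 5 * (8n - 2)]. *)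
    pose proof (HK y1 y2 j Hy1 Hy2 Hj).
    pose proof (K_y (yof k y1 y2) (xof k u y1 j) (yof_lt _ _ Hy1 Hy2)). lia. }
  destruct Hev as [s Hs].
  (* The residue stores [y1]; the multiple puts [v] beyond both [s] and [u], so the search below [v]
     finds [u]. *)
  set (v := (s + u + 1) * 2 ^ (3 * n) + y1). exists v.
  assert (Hv : s + u < v) by (unfold v; nia).
  assert (Erow : row2 k v = y1).
  { unfold row2, v. rewrite Nat.add_comm, Nat.Div0.mod_add. apply Nat.mod_small; exact Hy1. }
  assert (Esh : shift1 k v = u) by (apply bmin_eq; [lia|assumption|assumption]).
  unfold stage2. apply andb_true_intro. split; [apply bex_spec; exists u; split; [lia|assumption]|].
  apply Nat.leb_le. rewrite E52 at 1. apply Nat.mul_le_mono_l.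
  eapply Nat.le_trans; [exact HT|]. apply cnt_le. intros j Hj Hg.
  apply ball_spec. intros y2 Hy2. apply Nat.leb_le.
  unfold x2of. rewrite Esh, Erow. apply Hs; auto. lia.
Qed.

Lemma stage3_exists v :
  stage2 k v = true -> (forall j, j < v -> stage2 k j = false) ->
  (forall i, i < 2 ^ (5 * n) -> KN U (x2of k v i) 0 <= 5 * n + 2 * k) ->
  exists w, stage3 k w = true.
Proof.
  intros Hv Hmin HK. pose proof unit_of_eq as En.
  pose proof (pow2_pos n) as HM.
  pose proof (pow2_split (5 * n) n (4 * n) ltac:(lia)) as E5.
  pose proof (pow2_split (5 * n) 3 (5 * n - 3) ltac:(lia)) as E53.
  change (2 ^ 3) with 8 in *.
  pose proof Hv as Hc. unfold stage2 in Hc. apply andb_prop in Hc. destruct Hc as [_ Hc].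
  apply Nat.leb_le in Hc.
  assert (Hrow : row2 k v < 2 ^ (3 * n)).
  { apply Nat.mod_upper_bound. pose proof (pow2_pos (3 * n)). lia. }
  set (y1 := row2 k v) in *.
  set (G := fun j => ball (2 ^ n) (fun y2 => 2 <=? ph (x2of k v j) (yof k y1 y2) v)).
  change (2 ^ (5 * n) <= 4 * cnt (2 ^ (5 * n)) G) in Hc.
  set (L := fun y2 j => KN U (x2of k v j) (yof k y1 y2) <? 5 * n - 3).
  assert (Hev : exists s, forall t, s <= t -> forall j, j < 2 ^ (5 * n) ->
    forall y2, y2 < 2 ^ n -> (G j && negb (L y2 j))%bool = true ->
    3 <= ph (x2of k v j) (yof k y1 y2) t).
  { apply (eventually_bounded _ (fun j t => forall y2, y2 < 2 ^ n ->
      (G j && negb (L y2 j))%bool = true -> 3 <= ph (x2of k v j) (yof k y1 y2) t)). intros j Hj.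
    apply (eventually_bounded _ (fun y2 t => (G j && negb (L y2 j))%bool = true ->
      3 <= ph (x2of k v j) (yof k y1 y2) t)). intros y2 Hy2.
    destruct (G j && negb (L y2 j))%bool eqn:E; [|exists 0; discriminate].
    apply andb_prop in E. destruct E as [HG HnL].
    unfold G in HG. rewrite ball_spec in HG. specialize (HG y2 Hy2). apply Nat.leb_le in HG.
    apply Bool.negb_true_iff, Nat.ltb_ge in HnL.
    destruct (ph_up 2 _ _ v eq_refl HG) as [s Hs]; [|exists s; auto].
    pose proof (HK j Hj). pose proof (K_y (yof k y1 y2) 0 (yof_lt _ _ Hrow Hy2)). lia. }
  destruct Hev as [s Hs].
  (* For each [y2], a quarter of the block has fallen and less than an eighth is compressible given
     [y], which leaves an eighth to average over rotations. *)
  destruct (exists_rotation (2 ^ n) (2 ^ (5 * n - 3))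
    (fun y2 b => cnt (2 ^ (4 * n)) (fun r =>
      (G (b * 2 ^ (4 * n) + r) && negb (L y2 (b * 2 ^ (4 * n) + r)))%bool))) as [w0 [Hw0 HT]];
    [exact HM| |].
  { intros y2 _. unfold cnt.
    rewrite <- (nsum_mul _ _ (fun j => Nat.b2n (G j && negb (L y2 j)))), <- E5.
    fold (cnt (2 ^ (5 * n)) (fun j => (G j && negb (L y2 j))%bool)).
    pose proof (cnt_le_andb (2 ^ (5 * n)) G (L y2)) as H.
    pose proof (KN_count U (5 * n - 3) (x2of k v) (yof k y1 y2) (2 ^ (5 * n)) HU) as HL.
    specialize (HL ltac:(unfold x2of, xof; intros; lia)).
    change (cnt (2 ^ (5 * n)) (L y2) < 2 ^ (5 * n - 3)) in HL.
    lia. }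
  (* As with [v]: the residue is the rotation, and the size exceeds both [s] and [v]. *)
  set (w := (s + v + 1) * 2 ^ n + w0). exists w.
  assert (Hw : s + v < w) by (unfold w; nia).
  assert (Et : time2 k w = v) by (apply bmin_eq; [lia|assumption|assumption]).
  unfold stage3. apply andb_true_intro. split; [apply bex_spec; exists v; split; [lia|assumption]|].
  apply Nat.leb_le. rewrite E53 at 1. apply Nat.mul_le_mono_l.
  eapply Nat.le_trans; [exact HT|]. apply nsum_le. intros y2 Hy2. apply cnt_le. intros r Hr Hg.
  apply Nat.leb_le. unfold x3of. rewrite Et. fold y1.
  replace ((y2 + w) mod 2 ^ n) with ((y2 + w0) mod 2 ^ n).
  2:{ unfold w. replace (y2 + ((s + v + 1) * 2 ^ n + w0)) with (y2 + w0 + (s + v + 1) * 2 ^ n) by lia.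
      symmetry. apply Nat.Div0.mod_add. }
  apply Hs; [lia| |exact Hy2|exact Hg].
  pose proof (Nat.mod_upper_bound (y2 + w0) (2 ^ n) ltac:(lia)). nia.
Qed.

(** At least an eighth of the block has risen again and less than an eighth has complexity below
    [5n - 3], so some risen [x] is incompressible within the block; its NID is now about 4/5. *)
Lemma stage3_wins w :
  stage3 k w = true ->
  (forall y2 i, y2 < 2 ^ n -> i < 2 ^ (4 * n) ->
    KN U (x3of k w y2 i) (yof k (row2 k (time2 k w)) y2) <= 4 * n + 2 * k) ->
  exists x y s, 4 <= ph x y s.
Proof.
  intros Hw HK. pose proof unit_of_eq as En.
  pose proof (pow2_split (5 * n) n (4 * n) ltac:(lia)) as E5.
  pose proof (pow2_split (5 * n) 3 (5 * n - 3) ltac:(lia)) as E53.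
  change (2 ^ 3) with 8 in *.
  unfold stage3 in Hw. apply andb_prop in Hw. destruct Hw as [_ Hc]. apply Nat.leb_le in Hc.
  assert (Hrow : row2 k (time2 k w) < 2 ^ (3 * n)).
  { apply Nat.mod_upper_bound. pose proof (pow2_pos (3 * n)). lia. }
  set (y1 := row2 k (time2 k w)) in *.
  destruct (excluded_middle_informative (exists y2 r, y2 < 2 ^ n /\ r < 2 ^ (4 * n) /\
    3 <= ph (x3of k w y2 r) (yof k y1 y2) w /\ 5 * n - 3 <= KN U (x3of k w y2 r) 0))
    as [[y2 [r [Hy2 [Hr [H3 H5]]]]]|N].
  - destruct (ph_down 3 (x3of k w y2 r) (yof k y1 y2) w eq_refl H3) as [s Hs];
      [|exists (x3of k w y2 r), (yof k y1 y2), s; auto].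
    (* This is the tightest margin: [6 * (4n + 2k) < 5 * (5n - 3)] amounts to [12k + 15 < n]. *)
    pose proof (HK y2 r Hy2 Hr).
    pose proof (K_y (yof k y1 y2) (x3of k w y2 r) (yof_lt _ _ Hrow Hy2)). lia.
  - exfalso.
    assert (HL : nsum (2 ^ n) (fun y2 => cnt (2 ^ (4 * n)) (fun r =>
      KN U (x3of k w y2 r) 0 <? 5 * n - 3)) < 2 ^ (5 * n - 3)).
    (* Undoing the rotation lets [x] run once through the whole block. *)
    { unfold x3of.
      rewrite (nsum_rotate (2 ^ n) w (fun b => cnt (2 ^ (4 * n)) (fun r =>
        KN U (x2of k (time2 k w) (b * 2 ^ (4 * n) + r)) 0 <? 5 * n - 3))).
      unfold cnt.
      rewrite <- (nsum_mul _ _ (fun j => Nat.b2n (KN U (x2of k (time2 k w) j) 0 <? 5 * n - 3))).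
      apply (KN_count U (5 * n - 3) (x2of k (time2 k w)) 0); [exact HU|].
      unfold x2of, xof. intros; lia. }
    assert (H : nsum (2 ^ n) (fun y2 => cnt (2 ^ (4 * n)) (fun r =>
        3 <=? ph (x3of k w y2 r) (yof k y1 y2) w)) <=
      nsum (2 ^ n) (fun y2 => cnt (2 ^ (4 * n)) (fun r => KN U (x3of k w y2 r) 0 <? 5 * n - 3))).
    { apply nsum_le. intros y2 Hy2. apply cnt_le. intros r Hr Hp. apply Nat.leb_le in Hp.
      apply Nat.ltb_lt. destruct (le_lt_dec (5 * n - 3) (KN U (x3of k w y2 r) 0)); [|assumption].
      exfalso. apply N. exists y2, r. auto. }
    lia.
Qed.

End Stages.

Lemma four_oscillations : exists x y s, 4 <= ph x y s.
Proof.
  pose proof unit_of_comp as Hunit. pose proof xof_comp as Hxof. pose proof x2of_comp as Hx2.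
  pose proof x3of_comp as Hx3. pose proof stage1_comp as Hs1. pose proof stage2_comp as Hs2.
  pose proof stage3_comp as Hs3.
  assert (Ht : compb2 (fun _ _ => true)) by exact (comp_const 2 1).
  assert (Hi : comp4 (fun _ i _ _ => i)) by (unfold comp4; comp_tac).
  assert (H4 : comp1 (fun k => 4 * unit_of k)) by (unfold comp1; comp_tac).
  assert (H5 : comp1 (fun k => 5 * unit_of k)) by (unfold comp1; comp_tac).
  assert (H8 : comp1 (fun k => 8 * unit_of k)) by (unfold comp1; comp_tac).
  destruct (KN_search_le U _ _ _ HU H8 Ht Hi) as [c8 B8].
  destruct (KN_search_le U _ _ _ HU H4 Ht Hi) as [c4 B4].
  (* The quotient of the condition by [2 ^ n] is [y1]; the search supplies the rotation. *)
  destruct (KN_search_le U _ stage1 (fun k i y u => xof k u (y / 2 ^ unit_of k) i) HU H5 Hs1) as [c1 B1];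
    [unfold comp4; comp_tac|].
  (* The output does not depend on the condition, so this bounds the unconditional complexity on the
     chosen block. *)
  destruct (KN_search_le U _ stage2 (fun k i _ v => x2of k v i) HU H5 Hs2) as [c2 B2];
    [unfold comp4; comp_tac|].
  (* The remainder of the condition is [y2], while [y1] is recovered from [w]. *)
  destruct (KN_search_le U _ stage3 (fun k i y w => x3of k w (y mod 2 ^ unit_of k) i) HU H4 Hs3) as [c3 B3];
    [unfold comp4; comp_tac|].
  (* The machines are uniform in [k], so all constants are fixed before [k] is chosen above them. *)
  set (k := S (c8 + c4 + c1 + c2 + c3)).
  assert (Ky : forall x y, x < 2 ^ (4 * unit_of k) -> KN U x y <= 4 * unit_of k + 2 * k).
  { intros x y Hx. specialize (B4 k x y 0 Hx eq_refl ltac:(lia)). cbv beta in B4. lia. }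
  assert (Kx : forall x y, x < 2 ^ (8 * unit_of k) -> KN U x y <= 8 * unit_of k + 2 * k).
  { intros x y Hx. specialize (B8 k x y 0 Hx eq_refl ltac:(lia)). cbv beta in B8. lia. }
  assert (Ediv : forall y1 y2, y2 < 2 ^ unit_of k ->
    yof k y1 y2 / 2 ^ unit_of k = y1 /\ yof k y1 y2 mod 2 ^ unit_of k = y2).
  { intros y1 y2 Hy2. unfold yof. pose proof (pow2_pos (unit_of k)). split.
    - rewrite Nat.div_add_l by lia. rewrite Nat.div_small by assumption. lia.
    - rewrite Nat.add_comm, Nat.Div0.mod_add. apply Nat.mod_small; assumption. }
  destruct (least_witness_bool (stage1 k)) as [u [Hu Hu']];
    [apply stage1_exists; [lia|assumption|assumption]|].
  destruct (least_witness_bool (stage2 k)) as [v [Hv Hv']].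
  { apply (stage2_exists k ltac:(lia) Ky u Hu Hu'). intros y1 y2 i Hy1 Hy2 Hi5.
    specialize (B1 k i (yof k y1 y2) u Hi5 Hu Hu'). cbv beta in B1.
    rewrite (proj1 (Ediv y1 y2 Hy2)) in B1. lia. }
  destruct (least_witness_bool (stage3 k)) as [w [Hw Hw']].
  { apply (stage3_exists k ltac:(lia) Ky v Hv Hv'). intros i Hi5.
    specialize (B2 k i 0 v Hi5 Hv Hv'). cbv beta in B2. lia. }
  apply (stage3_wins k ltac:(lia) Ky w Hw). intros y2 i Hy2 Hi4.
  specialize (B3 k i (yof k (row2 k (time2 k w)) y2) w Hi4 Hw Hw'). cbv beta in B3.
  rewrite (proj2 (Ediv _ y2 Hy2)) in B3. lia.
Qed.

End Forcing.

(** * Oscillations of an approximation around 5/6 *)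

Lemma cpair_double a b : 2 * cpair a b = (a + b) * (a + b + 1) + 2 * b.
Proof.
  unfold cpair.
  assert (He : exists q, (a + b) * (a + b + 1) = q * 2).
  { destruct (Nat.Even_or_Odd (a + b)) as [[q Hq]|[q Hq]]; rewrite Hq;
      [exists (q * (2 * q + 1))|exists ((2 * q + 1) * (q + 1))]; nia. }
  destruct He as [q ->]. rewrite Nat.div_mul by discriminate. lia.
Qed.

(** Codes with different sums [a + b] lie in disjoint intervals between triangular numbers; on one
    diagonal the code determines [b]. *)
Lemma cpair_inj a b a' b' : cpair a b = cpair a' b' -> a = a' /\ b = b'.
Proof.
  intros H. pose proof (cpair_double a b). pose proof (cpair_double a' b').
  destruct (lt_eq_lt_dec (a + b) (a' + b')) as [[L|E]|L]; [nia| |nia].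
  rewrite E in *. lia.
Qed.

(** [encZ] sends a nonnegative numerator [a] to [2 * a] and negative ones to odd numbers, which
    never match. *)
Definition code_high (z : nat) : bool :=
  bex (S z) (fun a => bex (S z) (fun d => (cpair (2 * a) d =? z) && (5 * d <? 6 * a))%bool).

Lemma code_high_comp : compb1 code_high.
Proof.
  assert (comp2 cpair) by (unfold comp2, cpair; comp_tac).
  unfold compb1, comp1, code_high. comp_tac.
Qed.

Lemma code_high_spec q : code_high (encQ q) = true <-> (5 # 6 < q)%Q.
Proof.
  unfold code_high, Qlt. cbn [Qnum Qden]. rewrite bex_spec. split.
  - intros [a [_ Ha]]. apply bex_spec in Ha. destruct Ha as [d [_ Hd]].
    apply andb_prop in Hd. destruct Hd as [Ec Hlt]. apply Nat.eqb_eq in Ec. apply Nat.ltb_lt in Hlt.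
    unfold encQ in Ec. apply cpair_inj in Ec. destruct Ec as [E1 E2].
    unfold encZ in E1. destruct (Qnum q); lia.
  - intros H. exists (Z.to_nat (Qnum q)).
    assert (Hz : encZ (Qnum q) = 2 * Z.to_nat (Qnum q)) by (unfold encZ; destruct (Qnum q); lia).
    pose proof (cpair_double (encZ (Qnum q)) (Pos.to_nat (Qden q))) as Hd. fold (encQ q) in Hd.
    split; [nia|]. apply bex_spec. exists (Pos.to_nat (Qden q)). split; [nia|].
    apply andb_true_intro. rewrite <- Hz. split; [apply Nat.eqb_refl|apply Nat.ltb_lt; lia].
Qed.

(** The value before time 0 counts as [false], so the parity of the count agrees with the latest
    value. *)
Definition changes (h : nat -> bool) (s : nat) : nat :=
  cnt s (fun t => xorb (h t) (negb (t =? 0) && h (t - 1))).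

Lemma changes_mono h s t : s <= t -> changes h s <= changes h t.
Proof.
  intros H. unfold changes, cnt. replace t with (s + (t - s)) by lia. rewrite nsum_split. lia.
Qed.

Lemma changes_odd h s : Nat.odd (changes h (S s)) = h s.
Proof.
  induction s as [|s IH]; [unfold changes, cnt; simpl; destruct (h 0); reflexivity|].
  change (changes h (S (S s))) with
    (changes h (S s) + Nat.b2n (xorb (h (S s)) (negb (S s =? 0) && h (S s - 1)))).
  rewrite Nat.odd_add, IH. replace (S s - 1) with s by lia. simpl negb.
  destruct (h (S s)), (h s); reflexivity.
Qed.

(** Once [h] has settled on [b], the count is odd exactly if [b] is true; [j] has the opposite
    parity, so the count has moved past it. *)
Lemma changes_step h b s j :
  (exists s0, forall t, s0 <= t -> h t = b) -> Nat.even j = b -> j <= changes h s ->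
  exists s', forall t, s' <= t -> S j <= changes h t.
Proof.
  intros [s0 H0] Hb Hj. exists (S (Nat.max s s0)). intros [|t] Ht; [lia|].
  pose proof (changes_mono h s (S t) ltac:(lia)).
  pose proof (changes_odd h t) as Ho. rewrite (H0 t) in Ho by lia.
  destruct (Nat.eq_dec (changes h (S t)) j) as [E|]; [|lia].
  exfalso. rewrite E, <- Nat.negb_even, Hb in Ho. destruct b; discriminate.
Qed.

(** The witness is the time of change number [j + 1]. *)
Lemma changes_hit h j s :
  S j <= changes h s -> exists t, t < s /\ changes h t = j /\ h t = Nat.even j.
Proof.
  induction s as [|s IH]; [unfold changes, cnt; simpl; lia|]. intros H.
  destruct (le_lt_dec (S j) (changes h s)) as [L|L].
  - destruct (IH L) as [t Ht]. exists t. intuition lia.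
  - exists s. split; [lia|].
    assert (changes h (S s) <= S (changes h s)).
    { change (changes h (S s)) with
        (changes h s + Nat.b2n (xorb (h s) (negb (s =? 0) && h (s - 1)))).
      destruct (xorb _ _); simpl; lia. }
    split; [lia|]. rewrite <- (changes_odd h s).
    replace (changes h (S s)) with (S j) by lia. apply Nat.odd_succ.
Qed.

(** * Up-down-up sequences, and NID against 5/6 *)

Local Open Scope Q_scope.

Lemma Qle_steps_up (a : nat -> Q) l r :
  (forall t, (l <= t)%nat -> (S t < r)%nat -> a t <= a (S t)) ->
  forall i j, (l <= i <= j)%nat -> (j < r)%nat -> a i <= a j.
Proof.
  intros H i j Hij. replace j with (i + (j - i))%nat by lia.
  induction (j - i)%nat as [|d IH]; intros Hr.
  - rewrite Nat.add_0_r. apply Qle_refl.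
  - rewrite Nat.add_succ_r in *. eapply Qle_trans; [apply IH; lia|]. apply H; lia.
Qed.

(** The first fall puts [t2] beyond the first rising phase, the rise puts [t3] beyond the falling
    phase, and the last phase excludes the fall to [t4]. *)
Lemma SigmaSeq3_no_dips (a : nat -> Q) t1 t2 t3 t4 :
  SigmaSeq 3 a -> (t1 < t2 < t3)%nat -> (t3 < t4)%nat ->
  a t2 < a t1 -> a t2 < a t3 -> a t4 < a t3 -> False.
Proof.
  intros [s [Hup [s' [Hdown Hup']]]] Ht Ht4 H12 H23 H34. simpl in Hup'.
  assert (L2 : (s <= t2)%nat).
  { destruct (le_lt_dec s t2); [assumption|]. exfalso. apply (Qlt_not_le _ _ H12).
    apply (Qle_steps_up a 0 s); [intros; auto|lia|lia]. }
  assert (L3 : (s + s' <= t3)%nat).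
  { destruct (le_lt_dec (s + s') t3); [assumption|]. exfalso. apply (Qlt_not_le _ _ H23).
    assert (Hneg : - a t2 <= - a t3); [|apply Qopp_le_compat in Hneg; rewrite !Qopp_involutive in Hneg; exact Hneg].
    apply (Qle_steps_up (fun t => - a t) s (s + s')); [|lia|lia].
    intros t Hs Hlt. apply Qopp_le_compat.
    specialize (Hdown (t - s)%nat ltac:(lia)). cbv beta in Hdown.
    replace (s + S (t - s))%nat with (S t) in Hdown by lia.
    replace (s + (t - s))%nat with t in Hdown by lia. exact Hdown. }
  apply (Qlt_not_le _ _ H34).
  apply (Qle_steps_up a (s + s') (S t4)); [|lia|lia].
  intros t Hs _. specialize (Hup' (t - s - s')%nat).
  replace (s + (s' + S (t - s - s')))%nat with (S t) in Hup' by lia.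
  replace (s + (s' + (t - s - s')))%nat with t in Hup' by lia. exact Hup'.
Qed.

Lemma converges_above a l c :
  converges a l -> c < l -> exists s, forall t, (s <= t)%nat -> c < a t.
Proof.
  intros H Hc. destruct (H (l - c)) as [s Hs]; [lra|]. exists s. intros t Ht.
  specialize (Hs t Ht). apply Qabs_Qlt_condition in Hs. lra.
Qed.

Lemma converges_below a l c :
  converges a l -> l < c -> exists s, forall t, (s <= t)%nat -> a t < c.
Proof.
  intros H Hc. destruct (H (c - l)) as [s Hs]; [lra|]. exists s. intros t Ht.
  specialize (Hs t Ht). apply Qabs_Qlt_condition in Hs. lra.
Qed.

Lemma NID_dec U x y :
  NID U (dec x, dec y) =
  inject_Z (Z.of_nat (Nat.max (KN U x y) (KN U y x))) /
  inject_Z (Z.of_nat (Nat.max (KN U x 0) (KN U y 0))).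
Proof. unfold NID, E, K, KN. rewrite dec_0. reflexivity. Qed.

Lemma NID_high U x y :
  universal_pf U ->
  (5 * Nat.max (KN U x 0) (KN U y 0) < 6 * Nat.max (KN U x y) (KN U y x))%nat ->
  5 # 6 < NID U (dec x, dec y).
Proof.
  intros HU H. rewrite NID_dec. pose proof (KN_pos U HU x 0). pose proof (KN_pos U HU y 0).
  apply Qlt_shift_div_l.
  - change 0 with (inject_Z 0). rewrite <- Zlt_Qlt. lia.
  - unfold Qlt, Qmult, inject_Z. cbn [Qnum Qden]. lia.
Qed.

Lemma NID_low U x y :
  (6 * Nat.max (KN U x y) (KN U y x) < 5 * Nat.max (KN U x 0) (KN U y 0))%nat ->
  NID U (dec x, dec y) < 5 # 6.
Proof.
  intros H. rewrite NID_dec. apply Qlt_shift_div_r.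
  - change 0 with (inject_Z 0). rewrite <- Zlt_Qlt. lia.
  - unfold Qlt, Qmult, inject_Z. cbn [Qnum Qden]. lia.
Qed.

Theorem mainTheorem11 : forall U : prcode, universal_pf U -> ~ InSigma 3 (NID U).
Proof.
  intros U HU [f [[c Hc] [Hlim Hsig]]].
  set (h := fun x y t => code_high (encQ (f (dec x, dec y) t))).
  assert (Hh : forall x y t, h x y t = true <-> 5 # 6 < f (dec x, dec y) t)
    by (intros; apply code_high_spec).
  assert (HF : comp3 (fun x y t => encQ (f (dec x, dec y) t))).
  { exists c. intros e. specialize (Hc (dec (e 0%nat)) (dec (e 1%nat)) (e 2%nat)).
    rewrite !enc_dec in Hc. exact Hc. }
  pose proof code_high_comp as Hcode.
  assert (Hhc : compb3 h) by exact (comp_ap1 3 (fun z => Nat.b2n (code_high z)) _ Hcode HF).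
  assert (Hph : comp3 (fun x y s => changes (h x y) s)) by (unfold comp3, changes; comp_tac).
  destruct (four_oscillations U HU (fun x y s => changes (h x y) s) Hph) as [x [y [s Hs]]].
  - intros j x y s Hj Hle HK. apply (changes_step (h x y) true s j); [|exact Hj|exact Hle].
    destruct (converges_above _ _ _ (Hlim _) (NID_high U x y HU HK)) as [s0 H0].
    exists s0. intros t Ht. apply Hh, H0, Ht.
  - intros j x y s Hj Hle HK. apply (changes_step (h x y) false s j); [|exact Hj|exact Hle].
    destruct (converges_below _ _ _ (Hlim _) (NID_low U x y HK)) as [s0 H0].
    exists s0. intros t Ht. apply Bool.not_true_iff_false. rewrite Hh.
    apply Qle_not_lt, Qlt_le_weak, H0, Ht.
  (* The four changes are extracted from the last to the first, each being found before the next;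
     they alternate between values above 5/6 and values at most 5/6. *)
  - destruct (changes_hit _ _ _ Hs) as [t4 [_ [E4 H4]]].
    destruct (changes_hit (h x y) 2 t4) as [t3 [L3 [E3 H3]]]; [rewrite E4; apply le_n|].
    destruct (changes_hit (h x y) 1 t3) as [t2 [L2 [E2 H2]]]; [rewrite E3; apply le_n|].
    destruct (changes_hit (h x y) 0 t2) as [t1 [L1 [_ H1]]]; [rewrite E2; apply le_n|].
    apply Hh in H1. apply Hh in H3.
    apply Bool.not_true_iff_false in H2, H4. rewrite Hh in H2, H4.
    apply Qnot_lt_le in H2, H4.
    apply (SigmaSeq3_no_dips _ t1 t2 t3 t4 (Hsig (dec x, dec y))); try lia; lra.
Qed.
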